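(* Let $R$ be a ring and $I$ an ideal of $R$. Consider the following conditions: (1) Every finitely presented left $R$-module has a locally projective $I$-cover. (2) For every finitely generated left ideal $K$ of $R$, $R/K$ has a locally projective $I$-cover. (3) Every cyclically presented left $R$-module has a locally projective $I$-cover. (4) $R$ is $I$-semiregular. Then $(1)\Rightarrow(2)\Rightarrow(3)\Rightarrow(4)$, and $(4)\Rightarrow(1)$ holds if $R$ is a left PSD ring for $I$.
   Context: Rings are associative with identity; modules are unital left modules; ideals are two-sided. A ''summand'' is a direct summand; a ''projective summand'' is a direct summand that is a projective module. Locally projective: a module $P$ is locally projective if for all modules $A,B$, every epimorphism $g:A\to B$, every homomorphism $f:P\to B$ and every finitely generated submodule $P_0$ of $P$, there is a homomorphism $h:P\to A$ with $f|_{P_0}=gh|_{P_0}$. PSD: a submodule $N\leq M$ is PSD in $M$ if for every submodule $X\leq M$ with $N+X=M$ there is a projective summand $S$ of $M$ with $S\leq N$ and $M=S\oplus X$. A module $M$ is PSD for $I$ if every submodule of $IM$ is PSD in $M$. $R$ is a left PSD ring for $I$ if every finitely generated free left $R$-module is PSD for $I$. Locally projective $I$-cover: a pair $(P,f)$ is a locally projective $I$-cover of a module $M$ if $P$ is locally projective, $f:P\to M$ is an epimorphism with $\mathrm{Ker} f\leq IP$, and $\mathrm{Ker} f$ is PSD in $P$. A cyclically presented left $R$-module is one of the form $R/Rr$ with $r\in R$. $I$-semiregular: an element $m$ of a module $M$ is $I$-semiregular if there is a decomposition $M=P\oplus Q$ with $P$ projective, $P\subseteq Rm$ and $Rm\cap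 Q\subseteq IM$. $M$ is an $I$-semiregular module if each of its elements is $I$-semiregular. The ring $R$ is $I$-semiregular if ${}_RR$ is an $I$-semiregular module. *)

(* Defs.v *)
From HB Require Import structures.
From mathcomp Require Import all_boot all_order all_algebra boolp.

Set Implicit Arguments.
Unset Strict Implicit.
Unset Printing Implicit Defensive.

Import GRing.Theory.
Local Open Scope ring_scope.
Local Open Scope quotient_scope.

(* Submodules and ideals are boolean predicates, as in the algebra library.
   With the classical axioms of boolp every Prop-valued predicate is of this
   form (take `[< P >]) and every type is a choiceType, so neither this nor the
   choiceType carried by pzRingType and lmodType loses generality. *)

Section Submodules.
Variables (R : pzRingType) (M : lmodType R).
Implicit Types N X : submodClosed M.

Definition submodule_type N := {x : M | x \in N}.

HB.instance Definition _ N := SubChoice.on (submodule_type N).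
HB.instance Definition _ N :=
  [SubChoice_isSubLmodule of submodule_type N by <:].

(* submodClosed does not inherit from zmodClosed, which {quot _} requires. *)
Definition submodule_pred N : {pred M} := fun x => x \in N.

Lemma submodule_pred_zmod_closed N : zmod_closed (submodule_pred N).
Proof. exact: GRing.submod_closedB (submodClosedP N). Qed.

HB.instance Definition _ N :=
  GRing.isZmodClosed.Build M (submodule_pred N) (submodule_pred_zmod_closed N).

Definition quotient_module N : Type := Quotient.quot (submodule_pred N).

HB.instance Definition _ N := GRing.Zmodule.on (quotient_module N).

Section QuotientModule.
Variable N : submodClosed M.

Definition quotient_pi : M -> quotient_module N :=
  fun x => \pi_(Quotient.quot (submodule_pred N)) x.

Definition quotient_repr (x : quotient_module N) : M :=
  repr (x : Quotient.quot (submodule_pred N)).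

Lemma quotient_reprK : cancel quotient_repr quotient_pi.
Proof. by move=> x; rewrite /quotient_pi /quotient_repr reprK. Qed.

Lemma quotient_piP x y : quotient_pi x = quotient_pi y <-> x - y \in N.
Proof. by split=> [/eqP|h]; last apply/eqP; rewrite -Quotient.idealrBE. Qed.

Lemma quotient_piD : {morph quotient_pi : x y / x + y}.
Proof. by move=> x y; rewrite /quotient_pi; exact: raddfD. Qed.

Definition quotient_scale (a : R) (x : quotient_module N) :
  quotient_module N := quotient_pi (a *: quotient_repr x).

Lemma quotient_piZ a x : quotient_pi (a *: x) = quotient_scale a (quotient_pi x).
Proof.
by apply/quotient_piP; rewrite -scalerBr rpredZ //; apply/quotient_piP;
  rewrite quotient_reprK.
Qed.

Fact quotient_scaleA a b x :
  quotient_scale a (quotient_scale b x) = quotient_scale (a * b) x.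
Proof. by rewrite -[x]quotient_reprK -!quotient_piZ scalerA. Qed.

Fact quotient_scale1 : left_id 1 quotient_scale.
Proof. by move=> x; rewrite -[x]quotient_reprK -quotient_piZ scale1r. Qed.

Fact quotient_scaleDr : right_distributive quotient_scale +%R.
Proof.
move=> a x y; rewrite -[x]quotient_reprK -[y]quotient_reprK.
by rewrite -quotient_piD -!quotient_piZ -quotient_piD scalerDr.
Qed.

Fact quotient_scaleDl x : {morph quotient_scale^~ x : a b / a + b}.
Proof.
by move=> a b /=; rewrite -[x]quotient_reprK -!quotient_piZ -quotient_piD scalerDl.
Qed.

HB.instance Definition _ := GRing.Zmodule_isLmodule.Build R (quotient_module N)
  quotient_scaleA quotient_scale1 quotient_scaleDr quotient_scaleDl.

End QuotientModule.

Definition cyclic_submodule (m : M) : {pred M} :=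
  fun x => `[< exists a : R, x = a *: m >].

Fact cyclic_submodule_closed m : submod_closed (cyclic_submodule m).
Proof.
split=> [|a x y /asboolP[b ->] /asboolP[c ->]]; apply/asboolP.
  by exists 0; rewrite scale0r.
by exists (a * b + c); rewrite scalerDl scalerA.
Qed.

HB.instance Definition _ m := GRing.isSubmodClosed.Build R M
  (cyclic_submodule m) (cyclic_submodule_closed m).

Definition finitely_generated N : Prop :=
  exists (n : nat) (g : 'I_n -> M),
    forall x, x \in N <-> exists c : 'I_n -> R, x = \sum_i c i *: g i.

Definition sum_is_full N X : Prop :=
  forall m, exists x y, [/\ x \in N, y \in X & m = x + y].

Definition direct_decomposition N X : Prop :=
  sum_is_full N X /\ (forall m, m \in N -> m \in X -> m = 0).

Definition direct_summand N : Prop :=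
  exists X : submodClosed M, direct_decomposition N X.

End Submodules.

Section Kernel.
Variables (R : pzRingType) (A B : lmodType R) (f : {linear A -> B}).

Definition kernel : {pred A} := fun x => f x == 0.

Fact kernel_closed : submod_closed kernel.
Proof.
split=> [|a x y /eqP fx /eqP fy]; apply/eqP; first exact: linear0.
by rewrite linearP fx fy scaler0 addr0.
Qed.

HB.instance Definition _ := GRing.isSubmodClosed.Build R A kernel kernel_closed.

End Kernel.

Section Modules.
Variable R : pzRingType.

Definition epimorphism (A B : lmodType R) (f : {linear A -> B}) : Prop :=
  forall y, exists x, f x = y.

Definition isomorphic (A B : lmodType R) : Prop :=
  exists f : {linear A -> B}, bijective f.

Definition projective (P : lmodType R) : Prop :=
  forall (A B : lmodType R) (g : {linear A -> B}) (f : {linear P -> B}),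
    epimorphism g -> exists h : {linear P -> A}, forall x, f x = g (h x).

Definition locally_projective (P : lmodType R) : Prop :=
  forall (A B : lmodType R) (g : {linear A -> B}) (f : {linear P -> B})
         (P0 : submodClosed P),
    epimorphism g -> finitely_generated P0 ->
    exists h : {linear P -> A}, {in P0, forall x, f x = g (h x)}.

Definition finitely_presented (M : lmodType R) : Prop :=
  exists (n : nat) (f : {linear 'rV[R]_n -> M}),
    epimorphism f /\ finitely_generated (kernel f).

Definition cyclically_presented (M : lmodType R) : Prop :=
  exists r : R, isomorphic (quotient_module (cyclic_submodule (r : R^o))) M.

Definition finitely_generated_free (M : lmodType R) : Prop :=
  exists n : nat, isomorphic 'rV[R]_n M.

Definition projective_summand (M : lmodType R) (S : submodClosed M) : Prop :=
  direct_summand S /\ projective (submodule_type S).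

Definition PSD (M : lmodType R) (N : submodClosed M) : Prop :=
  forall X : submodClosed M, sum_is_full N X ->
    exists S : submodClosed M,
      [/\ projective_summand S, {subset S <= N} & direct_decomposition S X].

Definition two_sided_ideal (I : {pred R}) : Prop :=
  [/\ 0 \in I,
      {in I &, forall x y, x + y \in I}
    & forall a, {in I, forall x, a * x \in I /\ x * a \in I}].

Variable I : {pred R}.

(* I M, the finite sums of elements a *: m with a in I. *)
Definition ideal_mul (M : lmodType R) : {pred M} :=
  fun x => `[< exists (n : nat) (a : 'I_n -> R) (m : 'I_n -> M),
                 (forall k, a k \in I) /\ x = \sum_k a k *: m k >].
Arguments ideal_mul : clear implicits.

Definition PSD_module_for (M : lmodType R) : Prop :=
  forall N : submodClosed M, {subset N <= ideal_mul M} -> PSD N.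

Definition left_PSD_ring_for : Prop :=
  forall M : lmodType R, finitely_generated_free M -> PSD_module_for M.

Definition is_locally_projective_cover (P M : lmodType R)
    (f : {linear P -> M}) : Prop :=
  [/\ locally_projective P, epimorphism f,
      {subset kernel f <= ideal_mul P} & PSD (kernel f)].

Definition has_locally_projective_cover (M : lmodType R) : Prop :=
  exists (P : lmodType R) (f : {linear P -> M}), is_locally_projective_cover f.

Definition semiregular_element (M : lmodType R) (m : M) : Prop :=
  exists P Q : submodClosed M,
    [/\ direct_decomposition P Q, projective (submodule_type P),
        {subset P <= cyclic_submodule m}
      & forall x, x \in cyclic_submodule m -> x \in Q -> x \in ideal_mul M].

Definition semiregular_module (M : lmodType R) : Prop :=
  forall m : M, semiregular_element m.

Definition semiregular_ring : Prop := semiregular_module R^o.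

End Modules.

(* Main.v *)
(** From a cover [f : P -> R/Rr], lift [R -> R/Rr] to [g : R -> P].  The PSD
    condition gives [P = S (+) g R], and local projectivity along the
    epimorphism [R -> P/S] yields [h : P -> R] with [g h g = g].  Then [h g]
    is an idempotent endomorphism of [R] whose kernel and image form the
    decomposition required by semiregularity of [r].

    Conversely, call a submodule [K] of [M] split modulo [I] when
    [M = A (+) B] with [A <= K] and [K :&: B <= I M].  If [R] is
    [I]-semiregular, a row [m] of [R^n] is split coordinate by coordinate: an
    element [r = m_k] has some [t] with [r t] idempotent and
    [r - r t r] in [I], so passing from [m] to [(1 - r t) m] puts one more
    coordinate into [I].  Splittings then accumulate over generators, so every
    finitely generated kernel [K] of [R^n -> M] is split modulo [I], and the
    restriction [B -> M] is the cover. *)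
From HB Require Import structures.
Require Import Defs.
From mathcomp Require Import all_boot all_order all_algebra boolp.

Set Implicit Arguments.
Unset Strict Implicit.
Unset Printing Implicit Defensive.

Import GRing.Theory.
Local Open Scope ring_scope.

Local Arguments ideal_mul [R] I {M} _.

(** * Submodules, linear maps, projections and projectivity *)

Section ModuleConstructions.
Variable R : pzRingType.
Implicit Types A B M P : lmodType R.

(** Packages a closed Prop-valued condition, so that later submodules are obtained from their
    membership condition alone. *)
Lemma submodule_exists M (Q : M -> Prop) :
  Q 0 -> (forall a x y, Q x -> Q y -> Q (a *: x + y)) ->
  exists N : submodClosed M, forall x, x \in N <-> Q x.
Proof.
move=> Q0 QL; pose p : {pred M} := fun x => `[< Q x >].
have pP : submod_closed p.
  split=> [|a x y /asboolP Qx /asboolP Qy]; apply/asboolP => //.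
  exact: QL.
pose N : submodClosed M := HB.pack_for (submodClosed M) p
  (GRing.isSubmodClosed.Build R M p pP).
by exists N => x; split=> /asboolP.
Qed.

Lemma submodule_predB M (N : submodClosed M) x y :
  x \in N -> y \in N -> x - y \in N.
Proof. by move=> xN yN; rewrite -scaleN1r rpredD ?rpredZ. Qed.

Lemma linear_map_exists A B (f : A -> B) :
  (forall a x y, f (a *: x + y) = a *: f x + f y) ->
  exists g : {linear A -> B}, g =1 f.
Proof.
move=> fL.
pose g : {linear A -> B} := HB.pack_for {linear A -> B} f
  (GRing.isLinear.Build R A B *:%R f fL).
by exists g.
Qed.

Lemma submodule_val_linear M (N : submodClosed M) a (x y : submodule_type N) :
  val (a *: x + y) = a *: val x + val y.
Proof. exact: linearP. Qed.

Lemma quotient_pi_linear M (N : submodClosed M) a (x y : M) :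
  quotient_pi N (a *: x + y) = a *: quotient_pi N x + quotient_pi N y.
Proof. by rewrite quotient_piD quotient_piZ. Qed.

Lemma quotient_map_exists M (N : submodClosed M) :
  exists p : {linear M -> quotient_module N}, p =1 quotient_pi N.
Proof. exact/linear_map_exists/quotient_pi_linear. Qed.

Lemma cyclic_submoduleP M (m x : M) :
  x \in cyclic_submodule m <-> exists a, x = a *: m.
Proof. by split=> /asboolP. Qed.

Lemma cyclic_finitely_generated M (m : M) :
  finitely_generated (cyclic_submodule m).
Proof.
exists 1%N, (fun=> m) => x; split=> [/cyclic_submoduleP[a ->]|[c ->]].
  by exists (fun=> a); rewrite big_ord1.
by apply/cyclic_submoduleP; exists (c ord0); rewrite big_ord1.
Qed.

Lemma direct_decompositionC M (A B : submodClosed M) :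
  direct_decomposition A B -> direct_decomposition B A.
Proof.
case=> AB AB0; split=> [m|m mB mA]; last exact: AB0.
by have [x [y [xA yB ->]]] := AB m; exists y, x; rewrite addrC.
Qed.

Lemma direct_projection M (A B : submodClosed M) : direct_decomposition A B ->
  exists q : {linear M -> submodule_type A},
    (forall x, q (val x) = x) /\ (forall m, m - val (q m) \in B).
Proof.
case=> AB AB0.
have exq m : exists x : submodule_type A, m - val x \in B.
  have [x [y [xA yB ->]]] := AB m; exists (Sub x xA).
  by rewrite SubK addrC addKr.
have [q0 q0P] := choice exq.
(* The [A]-component is the only element of [A] congruent to [m] modulo [B]; this makes the chosen
   map linear and the identity on [A]. *)
have uniq m x : m - val x \in B -> q0 m = x.
  move=> mx; apply/eqP; rewrite -subr_eq0; apply/eqP/val_inj.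
  rewrite raddf0; apply: AB0; first exact: valP.
  suff -> : val (q0 m - x) = (m - val x) - (m - val (q0 m)).
    by rewrite submodule_predB.
  by rewrite raddfB /= opprB [RHS]addrC addrA subrK.
have [q qE] : exists q : {linear M -> submodule_type A}, q =1 q0.
  apply: linear_map_exists => a x y; apply: uniq.
  rewrite submodule_val_linear opprD addrACA -scalerBr rpredD ?q0P//.
  by rewrite rpredZ ?q0P.
exists q; split=> [x|m]; rewrite qE ?q0P//.
by apply: uniq; rewrite subrr rpred0.
Qed.

Lemma projective_summand_projective M (A B : submodClosed M) :
  projective M -> direct_decomposition A B -> projective (submodule_type A).
Proof.
move=> projM AB X Y g f epig; have [q [qK _]] := direct_projection AB.
have [h hP] := projM X Y g (f \o q) epig.
exists (h \o val) => x; by rewrite /= -hP /= qK.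
Qed.

Lemma projective_locally M : projective M -> locally_projective M.
Proof.
move=> projM A B g f N epig _; have [h hP] := projM A B g f epig.
by exists h => x _.
Qed.

Lemma projective_row n : projective ('rV[R]_n : lmodType R).
Proof.
move=> A B g f epig.
have [a aP] := choice (fun i : 'I_n => epig (f (delta_mx 0 i))).
have [h hE] : exists h : {linear 'rV[R]_n -> A},
    forall x, h x = \sum_i x 0 i *: a i.
  apply: linear_map_exists => c x y.
  rewrite scaler_sumr -big_split; apply: eq_bigr => i _ /=.
  by rewrite !mxE scalerDl scalerA.
exists h => x; rewrite hE [in LHS](row_sum_delta x) !linear_sum.
by apply: eq_bigr => i _; rewrite !linearZ /= aP.
Qed.

Lemma projective_regular : projective (R^o : lmodType R).
Proof.
move=> A B g f epig; have [a aP] := epig (f 1).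
have [h hE] : exists h : {linear R^o -> A}, forall x : R^o, h x = x *: a.
  by apply: linear_map_exists => c x y; rewrite scalerDl scalerA.
by exists h => x; rewrite hE linearZ /= aP -linearZ /= [_ *: _]mulr1.
Qed.

End ModuleConstructions.

(** * The multiples [I M] *)

Section IdealMultiples.
Variables (R : pzRingType) (I : {pred R}).
Hypothesis idealI : two_sided_ideal I.

Lemma ideal_mulP (M : lmodType R) (x : M) :
  x \in ideal_mul I <-> exists (n : nat) (a : 'I_n -> R) (m : 'I_n -> M),
    (forall k, a k \in I) /\ x = \sum_k a k *: m k.
Proof. by split=> /asboolP. Qed.

Lemma ideal_mul0 (M : lmodType R) : (0 : M) \in ideal_mul I.
Proof.
by apply/ideal_mulP; exists 0%N, (fun=> 0), (fun=> 0); split=> [[]//|];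
  rewrite big_ord0.
Qed.

Lemma ideal_mulD (M : lmodType R) (x y : M) :
  x \in ideal_mul I -> y \in ideal_mul I -> x + y \in ideal_mul I.
Proof.
move=> /ideal_mulP[n [a [u [aI ->]]]] /ideal_mulP[p [b [v [bI ->]]]].
apply/ideal_mulP; exists (n + p)%N.
exists (fun k => match split k with inl i => a i | inr j => b j end).
exists (fun k => match split k with inl i => u i | inr j => v j end).
split=> [k|]; first by case: (split k).
rewrite big_split_ord; congr (_ + _); apply: eq_bigr => i _ /=.
  by rewrite (unsplitK (inl i)).
by rewrite (unsplitK (inr i)).
Qed.

Lemma ideal_mulZ (M : lmodType R) a (x : M) :
  x \in ideal_mul I -> a *: x \in ideal_mul I.
Proof.
move=> /ideal_mulP[n [b [u [bI ->]]]]; apply/ideal_mulP.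
exists n, (fun k => a * b k), u; split=> [k|].
  by case: idealI => _ _ /(_ a _ (bI k))[].
by rewrite scaler_sumr; apply: eq_bigr => k _; rewrite scalerA.
Qed.

Lemma ideal_mulB (M : lmodType R) (x y : M) :
  x \in ideal_mul I -> y \in ideal_mul I -> x - y \in ideal_mul I.
Proof. by move=> xI yI; rewrite -scaleN1r ideal_mulD// ideal_mulZ. Qed.

Lemma linear_ideal_mul (M N : lmodType R) (f : {linear M -> N}) x :
  x \in ideal_mul I -> f x \in ideal_mul I.
Proof.
move=> /ideal_mulP[n [a [u [aI ->]]]]; apply/ideal_mulP.
exists n, a, (f \o u); split=> //.
by rewrite linear_sum; apply: eq_bigr => k _; rewrite linearZ.
Qed.

(** Each term [m 0 i *: delta_mx 0 i] is the image of an entry under a linear map from [R], and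
    linear maps send multiples of [I] to multiples of [I]. *)
Lemma ideal_mul_row n (m : 'rV[R]_n) :
  (forall i, (m 0 i : R^o) \in ideal_mul I) -> m \in ideal_mul I.
Proof.
move=> mI; rewrite (row_sum_delta m).
apply: (big_ind (fun x => x \in ideal_mul I)) => [||i _].
- exact: ideal_mul0.
- exact: ideal_mulD.
have [h hE] : exists h : {linear R^o -> 'rV[R]_n},
    forall x : R^o, h x = x *: delta_mx 0 i.
  by apply: linear_map_exists => a x y; rewrite scalerDl scalerA.
by have := linear_ideal_mul h (mI i); rewrite hE.
Qed.

End IdealMultiples.

(** * Splitting submodules modulo [I] *)

Section Semiregularity.
Variables (R : pzRingType) (I : {pred R}).
Hypothesis idealI : two_sided_ideal I.

Definition split_modulo (M : lmodType R) (K : submodClosed M) : Prop :=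
  exists A B : submodClosed M, [/\ direct_decomposition A B, {subset A <= K}
    & forall x, x \in K -> x \in B -> x \in ideal_mul I].

Lemma split_modulo_small (M : lmodType R) (K : submodClosed M) :
  {subset K <= ideal_mul I} -> split_modulo K.
Proof.
move=> KI.
have [A AP] : exists A : submodClosed M, forall x, x \in A <-> x = 0.
  by apply: submodule_exists => // a x y -> ->; rewrite scaler0 addr0.
have [B BP] : exists B : submodClosed M, forall x, x \in B <-> True.
  exact: submodule_exists.
exists A, B; split=> [|x /AP->|x xK _]; [|exact: rpred0|exact: KI].
split=> [m|m /AP//]; exists 0, m; split; [exact/AP|exact/BP|by rewrite add0r].
Qed.

(* A splitting of [L] refines the complement [B]: [B = C (+) (D :&: B)]. *)
Lemma split_modulo_extend (M : lmodType R) (A B K L : submodClosed M) :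
  direct_decomposition A B -> {subset A <= K} ->
  {subset L <= K} -> {subset L <= B} ->
  (forall x, x \in K -> x \in B ->
     exists2 l, l \in L & x - l \in ideal_mul I) ->
  split_modulo L -> split_modulo K.
Proof.
move=> [AB AB0] AK LK LB KB [C [D [[CD CD0] CL LD]]].
have [A' A'P] : exists A' : submodClosed M, forall x,
    x \in A' <-> exists a c, [/\ a \in A, c \in C & x = a + c].
  apply: submodule_exists => [|k x y [a [c [aA cC ->]]] [a' [c' [aA' cC' ->]]]].
    by exists 0, 0; rewrite !rpred0 addr0.
  exists (k *: a + a'), (k *: c + c').
  by rewrite !rpredD ?rpredZ// scalerDr addrACA.
have [B' B'P] : exists B' : submodClosed M, forall x,
    x \in B' <-> x \in B /\ x \in D.
  apply: submodule_exists => [|k x y [xB xD] [yB yD]]; first by rewrite !rpred0.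
  by rewrite !rpredD ?rpredZ.
exists A', B'; split.
- split=> [m|m /A'P[a [c [aA cC mE]]] /B'P[mB mD]].
    have [a [b [aA bB ->]]] := AB m; have [c [d [cC dD bE]]] := CD b.
    exists (a + c), d; split; last by rewrite -addrA -bE.
      by apply/A'P; exists a, c.
    apply/B'P; split=> //.
    (* Since [C <= L <= B], this is a difference of two elements of [B]. *)
    suff -> : d = b - c by rewrite submodule_predB// LB// CL.
    by rewrite bE addrC addKr.
  have a0 : a = 0.
    apply: AB0 => //; suff -> : a = m - c by rewrite submodule_predB// LB// CL.
    by rewrite mE addrK.
  by apply: CD0 => //; rewrite mE a0 add0r.
- by move=> x /A'P[a [c [aA cC ->]]]; rewrite rpredD//; [exact: AK|exact/LK/CL].
move=> x xK /B'P[xB xD]; have [l lL xlI] := KB x xK xB.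
have [p [pK pD]] := direct_projection (conj CD CD0).
(* [x = (x - l) + l] has trivial [C]-component, so [p (x - l) = - p l]. *)
have px : p x = 0.
  apply/val_inj; rewrite raddf0; apply: CD0; first exact: valP.
  have -> : val (p x) = x - (x - val (p x)) by rewrite subKr.
  by rewrite submodule_predB.
(* As [C <= L], this remainder lies in [L] as well as in [D]. *)
have lI : l - val (p l) \in ideal_mul I.
  by apply: LD => //; rewrite submodule_predB//; apply/CL/valP.
have plI : val (p (x - l)) \in ideal_mul I.
  exact: (linear_ideal_mul (val \o p : {linear M -> M}) xlI).
have -> : x = (x - l) - val (p (x - l)) + (l - val (p l)).
  have -> : p (x - l) = - p l by rewrite raddfB /= px sub0r.
  by rewrite (raddfN val) opprK addrACA subrK subrr addr0.
by apply: ideal_mulD => //; exact: ideal_mulB.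
Qed.

(** With [e = phi m], the map sending [x] to [phi x *: (e *: m)] projects [M] onto [R e m] with
    kernel [B]. The part of [R m] inside [B] is [R (m - e m)], so only that cyclic submodule is left
    to split. *)
Lemma split_modulo_idempotent (M : lmodType R) (phi : {linear M -> R^o}) (m : M) :
  phi m * phi m = phi m ->
  split_modulo (cyclic_submodule (m - (phi m : R) *: m)) ->
  split_modulo (cyclic_submodule m).
Proof.
set e : R := phi m => ee.
have phiem (a : R) : phi (a *: m) = a * e by rewrite linearZ.
have [B BP] : exists B : submodClosed M, forall x, x \in B <-> phi x * e = 0.
  apply: submodule_exists => [|a x y xB yB]; first by rewrite linear0 mul0r.
  by rewrite linearP mulrDl -[_ *: _]/(a * _) -mulrA xB yB mulr0 addr0.
apply: (@split_modulo_extend M (cyclic_submodule (e *: m)) B).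
- split=> [x|x /cyclic_submoduleP[a ->] /BP].
    exists ((phi x : R) *: (e *: m)), (x - (phi x : R) *: (e *: m)).
    split; last by rewrite addrC subrK.
      by apply/cyclic_submoduleP; exists (phi x).
    by apply/BP; rewrite scalerA raddfB /= phiem mulrBl -!mulrA !ee subrr.
  by rewrite scalerA phiem -!mulrA !ee => ->; rewrite scale0r.
- move=> x /cyclic_submoduleP[a ->]; apply/cyclic_submoduleP.
  by exists (a * e); rewrite scalerA.
- move=> x /cyclic_submoduleP[a ->]; apply/cyclic_submoduleP.
  by exists (a * (1 - e)); rewrite -scalerA scalerBl scale1r.
- move=> x /cyclic_submoduleP[a ->]; apply/BP.
  by rewrite linearZ raddfB /= phiem ee -/e subrr scaler0 mul0r.
move=> x /cyclic_submoduleP[a ->] /BP; rewrite phiem -mulrA ee => ae.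
(* From [a * e = 0] follows [a *: m = a *: (m - e *: m)], so [l = x] works. *)
exists (a *: m); last by rewrite subrr ideal_mul0.
by apply/cyclic_submoduleP; exists a; rewrite scalerBr scalerA ae scale0r subr0.
Qed.

(** The projection onto [P] is right multiplication by the idempotent [p 1 = s r]. Taking
    [t = s r s] makes [r t] idempotent, and [r - r t r = r - r s r] is the [Q]-component of [r],
    which also lies in [R r]. *)
Lemma semiregular_ring_idempotent (r : R) : semiregular_ring I ->
  exists t, (r * t) * (r * t) = r * t /\
    (r - r * t * r : R^o) \in @ideal_mul R I R^o.
Proof.
move=> /(_ r)[P [Q [PQ _ Pr rQ]]]; have [p [pK pQ]] := direct_projection PQ.
have pE (a : R) : val (p (a : R^o)) = a * (val (p (1 : R^o)) : R).
  by rewrite -[X in p X]mulr1 -[_ * _]/(a *: (1 : R^o)) !linearZ.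
have /Pr/cyclic_submoduleP[s sE] : val (p (1 : R^o)) \in P by exact: valP.
rewrite -[_ *: _]/(s * r) in sE; rewrite sE in pE.
have ee : s * r * (s * r) = s * r.
  by rewrite -pE -sE pK.
exists (s * r * s); split.
  have -> : r * (s * r * s) * (r * (s * r * s)) =
    r * (s * r * (s * r) * (s * r)) * s by rewrite !mulrA.
  by rewrite !ee !mulrA.
have -> : r - r * (s * r * s) * r = r - r * (s * r).
  by rewrite -[in RHS]ee !mulrA.
apply: rQ; last by rewrite -pE; exact: pQ.
by apply/cyclic_submoduleP; exists (1 - r * s); rewrite -[_ *: _]/(_ * _)
  mulrBl mul1r mulrA.
Qed.

Lemma split_modulo_row n (m : 'rV[R]_n) :
  semiregular_ring I -> split_modulo (cyclic_submodule m).
Proof.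
(* [k] counts the trailing entries not yet known to lie in [I]. *)
move=> sR; suff H k : (k <= n)%N ->
    forall x : 'rV[R]_n,
      (forall i : 'I_n, (i < n - k)%N -> (x 0 i : R^o) \in ideal_mul I) ->
      split_modulo (cyclic_submodule x).
  by apply: (H n) => // i; rewrite subnn.
elim: k => [_ x xI|k IHk kn x xI].
  apply: split_modulo_small => y /cyclic_submoduleP[a ->].
  apply: ideal_mulZ => //; apply: ideal_mul_row => // i.
  by apply: xI; rewrite subn0.
have jn : (n - k.+1 < n)%N by rewrite ltn_subrL (leq_trans _ kn).
pose j := Ordinal jn.
have [t [tt rtr]] := semiregular_ring_idempotent (x 0 j) sR.
have [phi phiE] : exists phi : {linear 'rV[R]_n -> R^o},
    forall y, phi y = y 0 j * t.
  by apply: linear_map_exists => a y z; rewrite !mxE mulrDl -mulrA.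
apply: (@split_modulo_idempotent _ phi); first by rewrite phiE.
(* Entry [j] becomes [r - r t r] for [r = x 0 j]; an earlier entry changes by a left multiple of
   itself and so stays in [I]. *)
apply: (IHk (ltnW kn)) => i; rewrite -subSS subSn// ltnS leq_eqVlt.
rewrite !mxE phiE => /orP[/eqP ij|ij].
  by rewrite (_ : i = j)//; exact: val_inj.
by apply: ideal_mulB => //; [|apply: (@ideal_mulZ _ _ idealI R^o)]; exact: xI.
Qed.

(** Induction on the number of generators. All but the last span [K'], split by [A] and [B];
    splitting the cyclic submodule of the [B]-component of the last generator then refines [B]. *)
Lemma split_modulo_finitely_generated (M : lmodType R) (K : submodClosed M) :
  (forall m : M, split_modulo (cyclic_submodule m)) ->
  finitely_generated K -> split_modulo K.
Proof.
move=> sM [n [g gP]]; elim: n K g gP => [|n IHn] K g gP.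
  apply: split_modulo_small => x /gP[c ->].
  by rewrite big_ord0 ideal_mul0.
have [K' K'P] : exists K' : submodClosed M, forall x, x \in K' <->
    exists c : 'I_n -> R, x = \sum_i c i *: g (widen_ord (leqnSn n) i).
  apply: submodule_exists => [|a x y [c ->] [d ->]].
    by exists (fun=> 0); rewrite big1// => i _; rewrite scale0r.
  exists (fun i => a * c i + d i); rewrite scaler_sumr -big_split.
  by apply: eq_bigr => i _; rewrite scalerDl scalerA.
have K'K x : x \in K' -> x \in K.
  move=> /K'P[c ->]; apply: rpred_sum => i _; apply: rpredZ; apply/gP.
  exists (fun j => (j == widen_ord (leqnSn n) i)%:R).
  rewrite (bigD1 (widen_ord (leqnSn n) i))//= eqxx scale1r big1 ?addr0// => j.
  by move=> /negPf->; rewrite scale0r.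
have gK : g ord_max \in K.
  apply/gP; exists (fun j => (j == ord_max)%:R).
  rewrite (bigD1 ord_max)//= eqxx scale1r big1 ?addr0// => j.
  by move=> /negPf->; rewrite scale0r.
have [A [B [AB AK' K'BI]]] := IHn _ _ K'P.
have [q [qK qA]] := direct_projection (direct_decompositionC AB).
have mqK x : x - val (q x) \in K by apply/K'K/AK'.
have qgK : val (q (g ord_max)) \in K.
  by rewrite -[val _](subKr (g ord_max)) submodule_predB.
apply: (split_modulo_extend AB _ _ _ _ (sM (val (q (g ord_max))))).
- by move=> x /AK'/K'K.
- by move=> x /cyclic_submoduleP[a ->]; rewrite rpredZ.
- by move=> x /cyclic_submoduleP[a ->]; apply: rpredZ; exact: valP.
move=> x /gP[c ->] xB; move: (xB).
rewrite big_ord_recr /=.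
set y := \sum_i _; set d := c ord_max => ydB.
exists (d *: val (q (g ord_max))); first by apply/cyclic_submoduleP; exists d.
have yK' : y \in K' by apply/K'P; exists (c \o widen_ord (leqnSn n)).
(* An element of [B] is fixed by [q], so what is left is [q y]; it lies in [K'] because
   [A <= K']. *)
have -> : y + d *: g ord_max - d *: val (q (g ord_max)) = val (q y).
  have -> : y + d *: g ord_max = val (q (y + d *: g ord_max)).
    apply/eqP; rewrite -subr_eq0; apply/eqP/AB.2; first exact: qA.
    by rewrite submodule_predB//; exact: valP.
  rewrite [y + _]addrC.
  have /= -> := linearP (val \o q : {linear M -> M}) d (g ord_max) y.
  by rewrite addrAC subrr add0r.
apply: K'BI; last exact: valP.
by rewrite -[val _](subKr y) submodule_predB// AK'.
Qed.

End Semiregularity.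

(** * Passing between covers and splittings *)

Section Covers.
Variables (R : pzRingType) (I : {pred R}).
Hypothesis idealI : two_sided_ideal I.

Lemma cover_isomorphic (M N : lmodType R) : isomorphic M N ->
  has_locally_projective_cover I M -> has_locally_projective_cover I N.
Proof.
move=> [u [v uK vK]] [P [f [lP epif kerI kerPSD]]].
have kE x : x \in kernel (u \o f) -> x \in kernel f.
  by move=> /eqP /= ufx; apply/eqP; apply: (can_inj uK); rewrite ufx linear0.
have kE' x : x \in kernel f -> x \in kernel (u \o f).
  by move=> /eqP /= fx; apply/eqP; rewrite /= fx linear0.
exists P, (u \o f); split=> // [y|x /kE/kerI//|X NX].
  by have [x fx] := epif (v y); exists x; rewrite /= fx vK.
have [|S [pS Sk SX]] := kerPSD X.
  by move=> m; have [x [y [/kE xk yX ->]]] := NX m; exists x, y.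
by exists S; split=> // x /Sk/kE'.
Qed.

(** ['rV[R]_1] plays the role of [R], so generators of [K] become generators of the kernel as
    constant rows. *)
Lemma finitely_presented_quotient (K : submodClosed R^o) :
  finitely_generated K -> finitely_presented (quotient_module K).
Proof.
move=> [n [g gP]].
have [f fE] : exists f : {linear 'rV[R]_1 -> quotient_module K},
    forall x, f x = quotient_pi K (x 0 0).
  by apply: linear_map_exists => a x y; rewrite !mxE; exact: quotient_pi_linear.
exists 1%N, f; split=> [y|].
  exists (const_mx (quotient_repr y : R)).
  by rewrite fE mxE quotient_reprK.
exists n, (fun i => const_mx (g i : R)) => x.
have -> : x \in kernel f <-> (x 0 0 : R^o) \in K.
  have -> : x \in kernel f <-> quotient_pi K (x 0 0) = quotient_pi K 0.
    rewrite -fE; have -> : quotient_pi K 0 = f 0 by rewrite fE mxE.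
    by rewrite linear0; split=> /eqP.
  by rewrite quotient_piP subr0.
rewrite gP; split=> -[c cE]; exists c.
  apply/rowP => i; rewrite ord1 cE summxE; apply: eq_bigr => j _.
  by rewrite !mxE.
by rewrite cE summxE; apply: eq_bigr => j _; rewrite !mxE.
Qed.

Lemma cover_semiregular (r : R) :
  has_locally_projective_cover I (quotient_module (cyclic_submodule (r : R^o))) ->
  @semiregular_element R I R^o r.
Proof.
set K := cyclic_submodule (r : R^o) => -[P [f [lP epif kerI kerPSD]]].
(* [p0] is the image of 1 under a lift [R -> P] of the quotient map. *)
have [p0 fp0] := epif (quotient_pi K 1).
have fa (a : R) : f (a *: p0) = quotient_pi K a.
  have [q qE] := quotient_map_exists K.
  by rewrite linearZ /= fp0 -!qE -linearZ /= [_ *: _]mulr1.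
have pi0 : quotient_pi K 0 = 0 by rewrite -fa scale0r linear0.
(* [f] already maps [R p0] onto [R/Rr], so [P = Ker f + R p0]. *)
have [|S [_ SK [SX SX0]]] := kerPSD (cyclic_submodule p0).
  move=> m; exists (m - (quotient_repr (f m) : R) *: p0).
  exists ((quotient_repr (f m) : R) *: p0); split; last by rewrite subrK.
    by apply/eqP; rewrite raddfB /= fa quotient_reprK subrr.
  by apply/cyclic_submoduleP; exists (quotient_repr (f m)).
have [g gE] : exists g : {linear R^o -> quotient_module S},
    forall a : R^o, g a = quotient_pi S ((a : R) *: p0).
  apply: linear_map_exists => c x y.
  by rewrite -quotient_pi_linear scalerA -scalerDl.
have epig : epimorphism g.
  move=> y; have [s [x [sS /cyclic_submoduleP[a ->] yE]]] := SX (quotient_repr y).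
  exists a; rewrite gE -[RHS]quotient_reprK yE.
  by apply/esym/quotient_piP; rewrite addrK.
have [p pE] := quotient_map_exists S.
have [h hP] := lP _ _ g p _ epig (cyclic_finitely_generated p0).
pose e : R := h p0.
have hE (a : R) : h (a *: p0) = a * e by rewrite linearZ.
(* Both sides agree modulo [S] and lie in [R p0], which meets [S] in 0. *)
have hK (a : R) : (a * e) *: p0 = a *: p0.
  have := hP (a *: p0); rewrite pE gE => /(_ _)/quotient_piP hS.
  apply/esym/eqP; rewrite -subr_eq0; apply/eqP; apply: SX0.
    have ap0 : a *: p0 \in cyclic_submodule p0.
      by apply/cyclic_submoduleP; exists a.
    by have := hS ap0; rewrite hE.
  by apply/cyclic_submoduleP; exists (a - a * e); rewrite scalerBl.
have ee : e * e = e by rewrite -hE -[X in X *: _]mul1r hK scale1r.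
(* The left annihilator of [e], that is [R (1 - e)], is the complement of [R e]. *)
have [A AP] : exists A : submodClosed R^o,
    forall x : R^o, x \in A <-> (x : R) * e = 0.
  apply: submodule_exists => [|a x y xA yA]; first by rewrite mul0r.
  by rewrite mulrDl -[_ *: _]/(a * _) -mulrA xA yA mulr0 addr0.
have AB : direct_decomposition A (cyclic_submodule (e : R^o)).
  split=> [m|m /AP mA /cyclic_submoduleP[a mE]].
    exists (m - (m : R) * e), ((m : R) * e); split; last by rewrite subrK.
      by apply/AP; rewrite mulrBl -mulrA ee subrr.
    by apply/cyclic_submoduleP; exists m.
  by move: mA; rewrite mE -[_ *: _]/(a * e) -mulrA ee.
exists A; eexists; split; first exact: AB.
- exact: projective_summand_projective (@projective_regular R) AB.
(* [x e = 0] forces [x p0 = 0], hence [x] vanishes in [R/Rr]. *)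
- move=> x /AP xe; rewrite -[x]subr0; apply/quotient_piP.
  have xp0 : (x : R) *: p0 = 0 by rewrite -hK xe scale0r.
  by rewrite pi0 -fa xp0 linear0.
move=> x xK /cyclic_submoduleP[a xE].
(* On [R e], [h] takes [x p0] back to [x]; for [x] in [R r], [x p0] lies in [Ker f <= I P]. *)
have -> : x = h ((x : R) *: p0).
  by rewrite hE xE -[_ *: _]/(a * e) -mulrA ee.
apply: linear_ideal_mul; apply: kerI; apply/eqP; rewrite fa.
by rewrite -pi0; apply/quotient_piP; rewrite subr0.
Qed.

(** Given [N + X = B], enlarging [X] to [X' = X + A] gives [N' + X' = F]. The summand [S] found in
    [F] lies in [N' <= B], so it can be read back in [B], whose summands are projective. *)
Lemma PSD_summand (F : lmodType R) (A B : submodClosed F)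
    (N : submodClosed (submodule_type B)) (N' : submodClosed F) :
  projective F -> direct_decomposition A B ->
  (forall x, x \in N' <-> exists2 y, y \in N & x = val y) ->
  PSD N' -> PSD N.
Proof.
move=> projF AB N'P psd X NX; have [_ AB0] := AB.
have BA := direct_decompositionC AB.
have [X' X'P] : exists X' : submodClosed F, forall x,
    x \in X' <-> exists y a, [/\ y \in X, a \in A & x = val y + a].
  apply: submodule_exists => [|k x y [b [a [bX aA ->]]] [b' [a' [bX' aA' ->]]]].
    by exists 0, 0; rewrite !rpred0 addr0.
  exists (k *: b + b'), (k *: a + a').
  split; rewrite ?submodule_val_linear ?rpredD ?rpredZ//.
  by rewrite scalerDr addrACA.
have [|S [_ SN [SX' SX'0]]] := psd X'.
  move=> m; have [a [b [aA bB ->]]] := AB.1 m.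
  have [x [y [xN yX bE]]] := NX (Sub b bB).
  exists (val x), (val y + a); split; last 1 first.
  - by have := congr1 val bE; rewrite (raddfD val) /= => ->; rewrite addrC addrA.
  - by apply/N'P; exists x.
  by apply/X'P; exists y, a.
have [T TP] : exists T : submodClosed (submodule_type B), forall x,
    x \in T <-> val x \in S.
  apply: submodule_exists => [|a x y xS yS]; first by rewrite raddf0 rpred0.
  by rewrite submodule_val_linear rpredD ?rpredZ.
have TX : direct_decomposition T X.
  split=> [m|m /TP mS mX].
    have [s [x [sS /X'P[y [a [yX aA xE]]] mE]]] := SX' (val m).
    have [z zN sE] := (N'P s).1 (SN _ sS).
    exists z, y; split=> //; first by apply/TP; rewrite -sE.
    (* [a] is a difference of elements of [B], so it lies in [A] and [B]. *)
    have a0 : a = 0.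
      apply: AB0 => //; suff -> : a = val m - (val z + val y).
        by rewrite submodule_predB// ?rpredD//; exact: valP.
      by rewrite mE sE xE [X in X - _]addrA [RHS]addrAC subrr add0r.
    by apply: val_inj; rewrite (raddfD val) /= mE sE xE a0 addr0.
  apply: val_inj; rewrite raddf0; apply: SX'0 => //.
  by apply/X'P; exists m, 0; rewrite rpred0 addr0.
exists T; split=> //.
  split; first by exists X.
  have projB := projective_summand_projective projF BA.
  exact: projective_summand_projective projB TX.
by move=> x /TP/SN/N'P[y yN /val_inj->].
Qed.

Lemma cover_of_split_kernel (F M : lmodType R) (f : {linear F -> M}) :
  projective F -> PSD_module_for I F -> epimorphism f ->
  split_modulo I (kernel f) -> has_locally_projective_cover I M.
Proof.
move=> projF psdF epif [A [B [AB AK KB]]].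
have BA := direct_decompositionC AB.
have [q [qK qA]] := direct_projection BA.
exists (submodule_type B), (f \o val); split.
- exact/projective_locally/(projective_summand_projective projF BA).
(* Since [A <= Ker f], [f] takes the same value on [x] and on its [B]-component. *)
- move=> y; have [x <-] := epif y; exists (q x).
  by apply/esym/eqP; rewrite -subr_eq0 -raddfB; exact: AK.
(* The splitting gives membership in [I F]; the linear map [q], which fixes [B], turns it into
   membership in [I B]. *)
- move=> x xK; rewrite -[x]qK; apply: linear_ideal_mul; apply: KB => //.
  exact: valP.
(* The kernel is viewed inside [F], where the PSD hypothesis applies. *)
have [N NP] : exists N : submodClosed F, forall x, x \in N <->
    exists2 y, y \in kernel (f \o (val : submodule_type B -> F)) & x = val y.
  apply: submodule_exists => [|a x y [b bK ->] [c cK ->]].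
    by exists 0; rewrite ?rpred0 ?raddf0.
  by exists (a *: b + c); rewrite ?rpredD ?rpredZ// submodule_val_linear.
apply: (PSD_summand projF AB NP); apply: psdF => x /NP[y yK ->].
by apply: KB; [exact: yK|exact: valP].
Qed.

End Covers.

Theorem theorem3p5 (R : pzRingType) (I : {pred R}) (idealI : two_sided_ideal I) :
  let c1 := forall M : lmodType R,
    finitely_presented M -> has_locally_projective_cover I M in
  let c2 := forall K : submodClosed R^o,
    finitely_generated K -> has_locally_projective_cover I (quotient_module K) in
  let c3 := forall M : lmodType R,
    cyclically_presented M -> has_locally_projective_cover I M in
  let c4 := semiregular_ring I in
  (c1 -> c2) /\ (c2 -> c3) /\ (c3 -> c4) /\ (left_PSD_ring_for I -> c4 -> c1).
Proof.
move=> c1 c2 c3 c4; split; [|split; [|split]].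
- by move=> C1 K /finitely_presented_quotient; exact: C1.
- move=> C2 M [r rM]; apply: cover_isomorphic rM _.
  exact/C2/cyclic_finitely_generated.
- move=> C3 r; apply: cover_semiregular; apply: C3; exists r.
  by exists idfun; exists idfun.
move=> psdR C4 M [n [f [epif fgK]]].
apply: (cover_of_split_kernel (@projective_row R n) _ epif).
  by apply: psdR; exists n, idfun; exists idfun.
apply: split_modulo_finitely_generated fgK => // m.
exact: split_modulo_row.
Qed.
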